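(* Let $\Lambda$ be a finitely aligned $k$-graph. Then (1) If every generalized cycle in $\Lambda$ has an entrance, then $\Lambda$ is aperiodic. (2) If $\Lambda$ is aperiodic, then every initial cycle in $\Lambda$ has an entrance.
   Context: $\mathbb{N}$ is the set of non-negative integers and $k\ge 1$ is an integer. $\mathbb{N}^k$ carries pointwise addition and the coordinatewise partial order $\le$; $m\vee n$ is the coordinatewise maximum; $e_1,\dots,e_k$ are the standard generators. **$k$-graphs.** A $k$-graph is a countable small category $\Lambda$ with range and source maps $r,s$, together with a functor $d:\Lambda\to\mathbb{N}^k$ such that whenever $d(\lambda)=m+n$ there are unique $\lambda_1,\lambda_2\in\Lambda$ with $d(\lambda_1)=m$, $d(\lambda_2)=n$, $\lambda=\lambda_1\lambda_2$. Objects (vertices) are identified with the paths of degree $0$; their set is $\Lambda^0$. The composite $\lambda\mu$ is defined iff $s(\lambda)=r(\mu)$. Write $v\Lambda=\{\lambda: r(\lambda)=v\}$ and $v\Lambda^n=\{\lambda\in v\Lambda:d(\lambda)=n\}$. $\mathrm{MCE}(\mu,\nu)$ is the set of paths $\lambda$ with $d(\lambda)=d(\mu)\vee d(\nu)$ and $\lambda=\mu\alpha=\nu\beta$ for some $\alpha,\beta\in\Lambda$, and $\Lambda^{\min}(\mu,\nu)=\{(\alpha,\beta):\mu\alpha=\nu\beta\in\mathrm{MCE}(\mu,\nu)\}$. $\Lambda$ is finitely aligned if $\Lambda^{\min}(\mu,\nu)$ is finite (possibly empty) for all $\mu,\nu$. **Exhaustive sets.** $E\subseteq v\Lambda$ is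 exhaustive if for every $\lambda\in v\Lambda$ there is $\mu\in E$ with $\Lambda^{\min}(\lambda,\mu)\neq\emptyset$. $v\mathrm{FE}(\Lambda)$ is the collection of finite exhaustive sets $E\subseteq v\Lambda\setminus\{v\}$. **Boundary paths, aperiodicity.** For $m\in(\mathbb{N}\cup\{\infty\})^k$, $\Omega_{k,m}=\{(p,q)\in\mathbb{N}^k\times\mathbb{N}^k: p\le q\le m\}$ is the $k$-graph with $r(p,q)=(p,p)$, $s(p,q)=(q,q)$, $d(p,q)=q-p$. A boundary path is a degree-preserving functor $x:\Omega_{k,m}\to\Lambda$ such that for all $p\in\mathbb{N}^k$, $p\le m$, and all $E\in x(p,p)\mathrm{FE}(\Lambda)$ there is $\mu\in E$ with $p+d(\mu)\le m$ and $x(p,p+d(\mu))=\mu$. Write $d(x)=m$, $r(x)=x(0,0)$; $v\partial\Lambda$ is the set of boundary paths with range $v$. For $n\in\mathbb{N}^k$, $n\le d(x)$, the shift $\sigma^n(x)$ is the boundary path of degree $d(x)-n$ with $\sigma^n(x)(p,q)=x(n+p,n+q)$. $\Lambda$ is aperiodic if for every $v\in\Lambda^0$ and $m\ne n\in\mathbb{N}^k$ there is $x\in v\partial\Lambda$ with either $m\vee n\not\le d(x)$ or $\sigma^m(x)\neq\sigma^n(x)$. **Generalized cycles.** A generalized cycle is a pair $(\mu,\nu)$ of distinct paths with $s(\mu)=s(\nu)$, $r(\mu)=r(\nu)$ and $\mathrm{MCE}(\mu\tau,\nu)\neq\emptyset$ for all $\tau\in s(\mu)\Lambda$. An entrance for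 $(\mu,\nu)$ is a path $\tau\in s(\nu)\Lambda$ with $\mathrm{MCE}(\mu,\nu\tau)=\emptyset$. A cycle is a path $\mu$ with $d(\mu)\neq0$ and $s(\mu)=r(\mu)$; it is regarded as the generalized cycle $(\mu,s(\mu))$, so an entrance for $\mu$ is a path $\tau\in s(\mu)\Lambda$ with $\mathrm{MCE}(\mu,\tau)=\emptyset$. A cycle $\mu$ is an initial cycle if $r(\mu)\Lambda^{e_i}=\emptyset$ whenever $d(\mu)_i=0$. *)

(* Defs.v *)
From mathcomp Require Import all_boot all_order ssralg.
From mathcomp Require Import boolp classical_sets functions cardinality.

Set Implicit Arguments.
Unset Strict Implicit.
Unset Printing Implicit Defensive.

Import GRing.Theory.
Local Open Scope classical_set_scope.
Local Open Scope ring_scope.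

(* N^k; its pointwise addition + and zero 0 are those of ssralg on {ffun _}. *)
Definition deg (k : nat) := {ffun 'I_k -> nat}.

Definition dle k (m n : deg k) : bool := [forall i, (m i <= n i)%N].
Definition dsub k (m n : deg k) : deg k := [ffun i => (m i - n i)%N].
Definition djoin k (m n : deg k) : deg k := [ffun i => maxn (m i) (n i)].
Definition dgen k (i : 'I_k) : deg k := [ffun j => (j == i) : nat].

(* (N u {oo})^k, with None standing for oo. *)
Definition edeg (k : nat) := {ffun 'I_k -> option nat}.

Definition dlee k (p : deg k) (m : edeg k) : bool :=
  [forall i, if m i is Some b then (p i <= b)%N else true].
Definition esub k (m : edeg k) (n : deg k) : edeg k :=
  [ffun i => if m i is Some b then Some (b - n i)%N else None].

(* [kg_comp l u] is the composite of l and u when s(l) = r(u); its value on   *)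
(* non-composable pairs is junk, constrained by no axiom.                     *)
Record kgraph (k : nat) := KGraph {
  kg_path :> Type;
  kg_vertex : Type;
  kg_r : kg_path -> kg_vertex;
  kg_s : kg_path -> kg_vertex;
  kg_id : kg_vertex -> kg_path;
  kg_comp : kg_path -> kg_path -> kg_path;
  kg_d : kg_path -> deg k;
  kg_countable : countable [set: kg_path];
  kg_r_id : forall v, kg_r (kg_id v) = v;
  kg_s_id : forall v, kg_s (kg_id v) = v;
  kg_r_comp : forall l u, kg_s l = kg_r u -> kg_r (kg_comp l u) = kg_r l;
  kg_s_comp : forall l u, kg_s l = kg_r u -> kg_s (kg_comp l u) = kg_s u;
  kg_id_comp : forall l, kg_comp (kg_id (kg_r l)) l = l;
  kg_comp_id : forall l, kg_comp l (kg_id (kg_s l)) = l;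
  kg_compA : forall l u t, kg_s l = kg_r u -> kg_s u = kg_r t ->
    kg_comp l (kg_comp u t) = kg_comp (kg_comp l u) t;
  kg_d_id : forall v, kg_d (kg_id v) = 0;
  kg_d_comp : forall l u, kg_s l = kg_r u ->
    kg_d (kg_comp l u) = kg_d l + kg_d u;
  kg_factor : forall l m n, kg_d l = m + n ->
    exists! p : kg_path * kg_path,
      [/\ kg_s p.1 = kg_r p.2, kg_d p.1 = m, kg_d p.2 = n
        & l = kg_comp p.1 p.2]
}.

(* The identification of the objects with the paths of degree 0. *)
Lemma kg_d0P k (L : kgraph k) (l : L) :
  kg_d l = 0 <-> exists v : kg_vertex L, l = kg_id v.
Proof.
split=> [dl|[v ->]]; last exact: kg_d_id.
exists (kg_r l).
have [p [_ pU]] : exists! p : L * L,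
    [/\ kg_s p.1 = kg_r p.2, kg_d p.1 = 0, kg_d p.2 = 0
      & l = kg_comp p.1 p.2] by apply: kg_factor; rewrite addr0.
have /pU pl : [/\ kg_s (l, kg_id (kg_s l)).1 = kg_r (l, kg_id (kg_s l)).2,
    kg_d (l, kg_id (kg_s l)).1 = 0, kg_d (l, kg_id (kg_s l)).2 = 0
  & l = kg_comp (l, kg_id (kg_s l)).1 (l, kg_id (kg_s l)).2].
  by split; rewrite /= ?kg_r_id ?kg_d_id ?kg_comp_id.
have /pU : [/\ kg_s (kg_id (kg_r l), l).1 = kg_r (kg_id (kg_r l), l).2,
    kg_d (kg_id (kg_r l), l).1 = 0, kg_d (kg_id (kg_r l), l).2 = 0
  & l = kg_comp (kg_id (kg_r l), l).1 (kg_id (kg_r l), l).2].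
  by split; rewrite /= ?kg_s_id ?kg_d_id ?kg_id_comp.
by rewrite pl => -[].
Qed.

Section KGraphNotions.
Variables (k : nat) (L : kgraph k).
Implicit Types (l mu nu tau : L) (v : kg_vertex L) (E : set L).

Definition paths_from v : set L := [set l | kg_r l = v].
Definition paths_from_deg v (n : deg k) : set L :=
  [set l | kg_r l = v /\ kg_d l = n].

Definition MCE mu nu : set L :=
  [set l | kg_d l = djoin (kg_d mu) (kg_d nu) /\
    exists a b : L, [/\ kg_s mu = kg_r a, kg_s nu = kg_r b,
                        l = kg_comp mu a & l = kg_comp nu b]].

Definition Lmin mu nu : set (L * L) :=
  [set ab | [/\ kg_s mu = kg_r ab.1, kg_s nu = kg_r ab.2,
                kg_comp mu ab.1 = kg_comp nu ab.2
              & MCE mu nu (kg_comp mu ab.1)]].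

Definition finitely_aligned : Prop :=
  forall mu nu, finite_set (Lmin mu nu).

Definition exhaustive v E : Prop :=
  E `<=` paths_from v /\
  forall l, paths_from v l -> exists2 mu, E mu & Lmin l mu !=set0.

Definition FE v : set (set L) :=
  [set E | [/\ finite_set E, E `<=` paths_from v `\ kg_id v
             & exhaustive v E]].

(* A morphism (p,q) of Omega_{k,m} is encoded by p and q separately: [px]     *)
(* matters only at those p, q with p <= q <= m.                               *)
Record pathdata := PathData {
  pd : edeg k;
  px : deg k -> deg k -> L
}.

Definition prange (x : pathdata) : kg_vertex L := kg_r (px x 0 0).

(* The value of x at the object p of Omega_{k,m} is the range of x(p,p).      *)
Definition is_kfunctor (x : pathdata) : Prop :=
  [/\ forall p, dlee p (pd x) -> px x p p = kg_id (kg_r (px x p p)),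
      forall p q, dle p q -> dlee q (pd x) ->
        kg_r (px x p q) = kg_r (px x p p) /\
        kg_s (px x p q) = kg_r (px x q q),
      forall p q t, dle p q -> dle q t -> dlee t (pd x) ->
        px x p t = kg_comp (px x p q) (px x q t)
    & forall p q, dle p q -> dlee q (pd x) -> kg_d (px x p q) = dsub q p].

Definition boundary_path (x : pathdata) : Prop :=
  is_kfunctor x /\
  forall p, dlee p (pd x) -> forall E, FE (kg_r (px x p p)) E ->
    exists mu, [/\ E mu, dlee (p + kg_d mu) (pd x)
                 & px x p (p + kg_d mu) = mu].

(* sigma^n(x), meaningful when n <= d(x). *)
Definition shift (n : deg k) (x : pathdata) : pathdata :=
  PathData (esub (pd x) n) (fun p q => px x (n + p) (n + q)).

(* Equality of the functors Omega_{k,m} -> Lambda encoded by x and y. *)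
Definition same_path (x y : pathdata) : Prop :=
  pd x = pd y /\
  forall p q, dle p q -> dlee q (pd x) -> px x p q = px y p q.

Definition aperiodic : Prop :=
  forall v (m n : deg k), m <> n ->
    exists x, [/\ boundary_path x, prange x = v
      & ~~ dlee (djoin m n) (pd x) \/ ~ same_path (shift m x) (shift n x)].

Definition generalized_cycle mu nu : Prop :=
  [/\ mu <> nu, kg_s mu = kg_s nu, kg_r mu = kg_r nu
    & forall tau, paths_from (kg_s mu) tau ->
        MCE (kg_comp mu tau) nu !=set0].

Definition entrance mu nu tau : Prop :=
  paths_from (kg_s nu) tau /\ MCE mu (kg_comp nu tau) = set0.

Definition cycle mu : Prop := kg_d mu <> 0 /\ kg_s mu = kg_r mu.

Definition cycle_entrance mu tau : Prop := entrance mu (kg_id (kg_s mu)) tau.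

Lemma cycle_entranceE mu tau :
  cycle_entrance mu tau <-> paths_from (kg_s mu) tau /\ MCE mu tau = set0.
Proof.
rewrite /cycle_entrance /entrance /paths_from /= kg_s_id.
by split=> -[rt]; rewrite -rt kg_id_comp.
Qed.

Definition initial_cycle mu : Prop :=
  cycle mu /\
  forall i, kg_d mu i = 0%N -> paths_from_deg (kg_r mu) (dgen i) = set0.

Lemma dlee_shift (n p : deg k) (m : edeg k) :
  dlee n m -> dlee p (esub m n) = dlee (n + p) m.
Proof.
move=> /forallP nm; apply: eq_forallb => i; rewrite !ffunE.
by case: (m i) (nm i) => // b nb; rewrite leq_subRL.
Qed.

Lemma boundary_shift (n : deg k) (x : pathdata) :
  dlee n (pd x) -> boundary_path x -> boundary_path (shift n x).
Proof.
move=> nx [[xid xrs xcomp xd] xb].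
have dleD (p q : deg k) : dle p q -> dle (n + p) (n + q).
  by move=> /forallP pq; apply/forallP => i; rewrite !ffunE leq_add2l.
split; first split.
- by move=> p /=; rewrite dlee_shift//; exact: xid.
- by move=> p q /dleD pq /=; rewrite dlee_shift//; exact: xrs.
- by move=> p q t /dleD pq /dleD qt /=; rewrite dlee_shift//; exact: xcomp.
- move=> p q /dleD pq /=; rewrite dlee_shift// => qx; rewrite (xd _ _ pq qx).
  by apply/ffunP => i; rewrite !ffunE subnDl.
move=> p /=; rewrite dlee_shift// => px E /(xb _ px) [mu [Emu le_mu xmu]].
by exists mu; rewrite dlee_shift// addrA.
Qed.

End KGraphNotions.

(* Main.v *)
(* (1) Every path l is an initial segment of a boundary path. If every x in
   v(dL) satisfies m v n <= d(x) and sigma^m(x) = sigma^n(x), fix one such x and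
   write x(0, m v n) = mu a = nu b with d(mu) = m, d(nu) = n. For each t in
   s(a)L, a boundary path z extending mu a t = nu b t shows that
   sigma^m(z) = sigma^n(z) starts with both a t and b t. Hence (a, b) is a
   generalized cycle without an entrance.
   (2) If the initial cycle mu has no entrance, {mu} is a finite exhaustive set,
   so every boundary path with range r(mu) starts with mu, and so does its
   shift by d(mu), and so on: mu^oo is the only boundary path there, and it is
   invariant under the shift by d(mu). *)
Require Import Defs.
From mathcomp Require Import all_boot.
From mathcomp Require Import ssralg boolp classical_sets functions cardinality.

Set Implicit Arguments.
Unset Strict Implicit.
Unset Printing Implicit Defensive.

Import GRing.Theory.

(** * Order, joins and suprema of degrees *)

Section Degrees.
Local Open Scope ring_scope.
Variable k : nat.
Implicit Types (m n p q : deg k) (b : edeg k).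

Lemma dleP m n : reflect (forall i, (m i <= n i)%N) (dle m n).
Proof. exact: forallP. Qed.

Lemma dle_refl m : dle m m.
Proof. by apply/dleP. Qed.

Lemma dle_trans n m p : dle m n -> dle n p -> dle m p.
Proof. by move=> /dleP mn /dleP np; apply/dleP => i; exact: leq_trans (np i). Qed.

Lemma dle0 m : dle 0 m.
Proof. by apply/dleP => i; rewrite !ffunE. Qed.

Lemma dle_addr m n : dle m (m + n).
Proof. by apply/dleP => i; rewrite !ffunE; exact: leq_addr. Qed.

Lemma dsubKC m n : dle m n -> m + dsub n m = n.
Proof. by move=> /dleP mn; apply/ffunP => i; rewrite !ffunE; exact: subnKC. Qed.

Lemma dsubn0 n : dsub n 0 = n.
Proof. by apply/ffunP => i; rewrite !ffunE; exact: subn0. Qed.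

Lemma daddrI m n p : m + n = m + p -> n = p.
Proof.
move=> /ffunP e; apply/ffunP => i; move: (e i); rewrite !ffunE.
exact: addnI.
Qed.

Lemma djoinC m n : djoin m n = djoin n m.
Proof. by apply/ffunP => i; rewrite !ffunE maxnC. Qed.

Lemma dle_joinl m n : dle m (djoin m n).
Proof. by apply/dleP => i; rewrite !ffunE leq_maxl. Qed.

Lemma dle_joinr m n : dle n (djoin m n).
Proof. by rewrite djoinC dle_joinl. Qed.

Lemma dlee_trans m n b : dle m n -> dlee n b -> dlee m b.
Proof.
move=> /dleP mn /forallP nb; apply/forallP => i; have := nb i.
by case: (b i) => // c; exact: leq_trans.
Qed.

Lemma dlee_join m n b : dlee m b -> dlee n b -> dlee (djoin m n) b.
Proof.
move=> /forallP mb /forallP nb; apply/forallP => i; have := mb i; have := nb i.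
by case: (b i) => // c; rewrite ffunE geq_max => -> ->.
Qed.

Lemma dlee0 b : dlee 0 b.
Proof. by apply/forallP => i; case: (b i) => // c; rewrite ffunE. Qed.

(* The supremum in (N u {oo})^k is attained below finite degrees because the
   sequence is directed. *)
Lemma edeg_sup (u : nat -> deg k) :
  (forall i j, (i <= j)%N -> dle (u i) (u j)) ->
  exists b, forall q, dlee q b <-> exists j, dle q (u j).
Proof.
move=> umono.
have sup1 (i : 'I_k) : exists o : option nat, forall c,
    is_true (if o is Some b then (c <= b)%N else true) <-> exists j, (c <= u j i)%N.
  have [[B uB]|unb] := pselect (exists B, forall j, (u j i <= B)%N).
    have exP : exists c, `[< exists j, (c <= u j i)%N >].
      by exists 0%N; apply/asboolP; exists 0%N.
    have ubP c : `[< exists j, (c <= u j i)%N >] -> (c <= B)%N.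
      by move=> /asboolP [j]; move/leq_trans; apply.
    case: (ex_maxnP exP ubP) => M /asboolP [j Mj] Mmax.
    exists (Some M) => c; split=> [cM|[j' cj']].
      by exists j; exact: leq_trans Mj.
    by apply: Mmax; apply/asboolP; exists j'.
  exists None => c; split=> // _; apply: contrapT => nc; apply: unb.
  exists c => j; rewrite leqNgt; apply/negP => cj; apply: nc.
  by exists j; exact: ltnW.
have [o oP] := choice sup1.
exists [ffun i => o i] => q; split=> [/forallP qo|[j /dleP qj]]; last first.
  by apply/forallP => i; rewrite ffunE; apply/oP; exists j.
have /choice [J JP] : forall i, exists j, (q i <= u j i)%N.
  by move=> i; apply/oP; have := qo i; rewrite ffunE.
exists (\max_i J i)%N; apply/dleP => i; apply: leq_trans (JP i) _.
by have /dleP := umono _ _ (leq_bigmax (F := J) i); apply.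
Qed.

End Degrees.

(** * Unique factorization and the prefix order *)

Section Paths.
Local Open Scope ring_scope.
Local Open Scope classical_set_scope.
Variables (k : nat) (L : kgraph k).
Implicit Types (a b c l mu nu : L) (x y : pathdata L) (p q m n : deg k).

(** Cancelling degrees gives the second factors equal degrees too, so the uniqueness in [kg_factor]
    identifies the two factorizations. *)
Lemma kg_comp_inj a b a' b' : kg_s a = kg_r b -> kg_s a' = kg_r b' ->
  kg_d a = kg_d a' -> kg_comp a b = kg_comp a' b' -> a = a' /\ b = b'.
Proof.
move=> ab ab' da e.
have db : kg_d b = kg_d b'.
  by apply: (@daddrI _ (kg_d a)); rewrite -kg_d_comp// e kg_d_comp// da.
have [z [_ zU]] := @kg_factor k L _ _ _ (kg_d_comp ab).
have /zU z1 : [/\ kg_s (a, b).1 = kg_r (a, b).2, kg_d (a, b).1 = kg_d a,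
  kg_d (a, b).2 = kg_d b & kg_comp a b = kg_comp (a, b).1 (a, b).2] by [].
have /zU : [/\ kg_s (a', b').1 = kg_r (a', b').2, kg_d (a', b').1 = kg_d a,
  kg_d (a', b').2 = kg_d b & kg_comp a b = kg_comp (a', b').1 (a', b').2] by [].
by rewrite z1 => -[].
Qed.

Definition prefix a l := exists b, kg_s a = kg_r b /\ l = kg_comp a b.

Lemma prefix_refl l : prefix l l.
Proof. by exists (kg_id (kg_s l)); rewrite kg_r_id kg_comp_id. Qed.

Lemma prefix_comp a b : kg_s a = kg_r b -> prefix a (kg_comp a b).
Proof. by move=> ab; exists b. Qed.

Lemma prefix_trans b a c : prefix a b -> prefix b c -> prefix a c.
Proof.
move=> [t [at_ ->]] [u []]; rewrite kg_s_comp// => tu ->.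
by exists (kg_comp t u); rewrite kg_r_comp// kg_compA.
Qed.

Lemma prefix_dle a l : prefix a l -> dle (kg_d a) (kg_d l).
Proof. by move=> [b [ab ->]]; rewrite kg_d_comp// dle_addr. Qed.

Lemma prefix_exists l q : dle q (kg_d l) -> exists2 a, kg_d a = q & prefix a l.
Proof.
move=> ql; have [[a b] [[/= ab da _ lab] _]] := kg_factor (esym (dsubKC ql)).
by exists a => //; exists b.
Qed.

(** The initial factor [c] of [b] of degree [kg_d a] is also one of [l], hence equals [a] by unique
    factorization. *)
Lemma prefix_total a b l :
  prefix a l -> prefix b l -> dle (kg_d a) (kg_d b) -> prefix a b.
Proof.
move=> [a1 [aa1 la]] [b1 [bb1 lb]] ab.
have [c dc [c1 [cc1 bc]]] := prefix_exists ab.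
have c1b1 : kg_s c1 = kg_r b1 by rewrite -bb1 bc kg_s_comp.
have [-> _] : a = c /\ a1 = kg_comp c1 b1.
  apply: kg_comp_inj; rewrite ?kg_r_comp//.
  by rewrite -la lb {1}bc kg_compA.
by exists c1.
Qed.

Lemma prefix_eq a b : prefix a b -> kg_d a = kg_d b -> a = b.
Proof.
move=> [c [ac e]] d.
have [] : a = b /\ c = kg_id (kg_s b); last by [].
by apply: kg_comp_inj; rewrite ?kg_r_id ?kg_comp_id.
Qed.

Lemma prefix_MCE a b c : kg_d c = djoin (kg_d a) (kg_d b) ->
  prefix a c -> prefix b c -> MCE a b c.
Proof. by move=> dc [a1 [? ?]] [b1 [? ?]]; split=> //; exists a1, b1. Qed.

(** * Functors and their initial segments *)

Lemma kfunctor_prefix x p q : is_kfunctor x -> dle p q -> dlee q (pd x) ->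
  prefix (px x 0 p) (px x 0 q).
Proof.
move=> [_ xrs xc _] pq qx; exists (px x p q); split; last exact: xc (dle0 _) _ _.
by rewrite (xrs _ _ (dle0 p) (dlee_trans pq qx)).2 (xrs _ _ pq qx).1.
Qed.

Lemma kfunctor_d0 x q : is_kfunctor x -> dlee q (pd x) -> kg_d (px x 0 q) = q.
Proof. by move=> [_ _ _ xd] qx; rewrite xd ?dle0// dsubn0. Qed.

Lemma kfunctor_shift0 x p q : is_kfunctor x -> dlee (p + q) (pd x) ->
  kg_s (px x 0 p) = kg_r (px (shift p x) 0 q) /\
  px x 0 (p + q) = kg_comp (px x 0 p) (px (shift p x) 0 q).
Proof.
move=> [_ xrs xc _] pqx; rewrite /= addr0.
have ppq := dle_addr p q.
split; last exact: xc (dle0 _) _ _.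
by rewrite (xrs _ _ (dle0 p) (dlee_trans ppq pqx)).2 (xrs _ _ ppq pqx).1.
Qed.

Lemma kfunctor_MCE x p q : is_kfunctor x -> dlee p (pd x) -> dlee q (pd x) ->
  MCE (px x 0 p) (px x 0 q) (px x 0 (djoin p q)).
Proof.
move=> xf px_ qx; have pqx := dlee_join px_ qx.
apply: prefix_MCE; first by rewrite !kfunctor_d0.
- by apply: kfunctor_prefix => //; exact: dle_joinl.
- by apply: kfunctor_prefix => //; exact: dle_joinr.
Qed.

(** Agreement at cofinally many degrees passes to all prefixes, and then to [px x p q] by cancelling
    [px x 0 p]. *)
Lemma same_path_prefix x y : is_kfunctor x -> is_kfunctor y -> pd x = pd y ->
  (forall q, dlee q (pd x) -> exists q', [/\ dle q q', dlee q' (pd x) &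
    px x 0 q' = px y 0 q']) -> same_path x y.
Proof.
move=> xf yf dxy H; split=> //.
have H0 q : dlee q (pd x) -> px x 0 q = px y 0 q.
  move=> qx; have [q' [qq' q'x e]] := H _ qx.
  have qy : dlee q (pd y) by rewrite -dxy.
  have q'y : dlee q' (pd y) by rewrite -dxy.
  apply: prefix_eq; last by rewrite !kfunctor_d0.
  apply: (@prefix_total _ _ (px x 0 q')).
  - exact: kfunctor_prefix.
  - by rewrite e; exact: kfunctor_prefix.
  - by rewrite !kfunctor_d0// dle_refl.
move=> p q pq qx; have px_ := dlee_trans pq qx.
have qy : dlee q (pd y) by rewrite -dxy.
have := kfunctor_shift0 xf (p := p) (q := dsub q p).
have := kfunctor_shift0 yf (p := p) (q := dsub q p).
rewrite /= !addr0 !dsubKC// => /(_ qy) [y1 y2] /(_ qx) [x1 x2].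
have [] // : px x 0 p = px y 0 p /\ px x p q = px y p q.
by apply: kg_comp_inj; rewrite // ?H0// -?y2 -?H0.
Qed.

(** The value at [(p, q)] is what remains of [F q] after [F p]; the functor laws follow by left
    cancellation. *)
Lemma kfunctor_of_prefixes (b : edeg k) (F : deg k -> L) :
  (forall q, dlee q b -> kg_d (F q) = q) ->
  (forall p q, dle p q -> dlee q b -> prefix (F p) (F q)) ->
  exists x, [/\ pd x = b, is_kfunctor x
    & forall p q, dle p q -> dlee q b ->
        kg_s (F p) = kg_r (px x p q) /\ F q = kg_comp (F p) (px x p q)].
Proof.
move=> Fd Fp.
have /choice [f fP] (pq : deg k * deg k) : exists c,
    dle pq.1 pq.2 -> dlee pq.2 b ->
    kg_s (F pq.1) = kg_r c /\ F pq.2 = kg_comp (F pq.1) c.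
  have [[le_pq qb]|n] := pselect (dle pq.1 pq.2 /\ dlee pq.2 b).
    by have [c] := Fp _ _ le_pq qb; exists c.
  by exists (F 0) => ? ?; case: n.
have {}fP p q : dle p q -> dlee q b ->
    kg_s (F p) = kg_r (f (p, q)) /\ F q = kg_comp (F p) (f (p, q)).
  exact: fP (p, q).
have fid p : dlee p b -> f (p, p) = kg_id (kg_s (F p)).
  move=> pb; have [r1 e1] := fP _ _ (dle_refl p) pb.
  have [] // : F p = F p /\ f (p, p) = kg_id (kg_s (F p)).
  by apply: kg_comp_inj; rewrite ?kg_r_id// -e1 kg_comp_id.
exists (PathData b (fun p q => f (p, q))); split=> //; split=> /=.
- by move=> p pb; rewrite fid// kg_r_id.
- move=> p q pq qb; rewrite !fid ?(dlee_trans pq)// !kg_r_id.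
  by have [-> ->] := fP _ _ pq qb; rewrite kg_s_comp// (fP _ _ pq qb).1.
- move=> p q t pq qt tb.
  have qb := dlee_trans qt tb.
  have [r1 e1] := fP _ _ pq qb; have [r2 e2] := fP _ _ qt tb.
  have [r3 e3] := fP _ _ (dle_trans pq qt) tb.
  have r12 : kg_s (f (p, q)) = kg_r (f (q, t)) by rewrite -r2 e1 kg_s_comp.
  have [] // : F p = F p /\ f (p, t) = kg_comp (f (p, q)) (f (q, t)).
  by apply: kg_comp_inj; rewrite ?kg_r_comp// -e3 e2 {1}e1 kg_compA.
- move=> p q pq qb; have [r e] := fP _ _ pq qb.
  apply: (@daddrI _ p); rewrite dsubKC// -{1}(Fd p) ?(dlee_trans pq)//.
  by rewrite -kg_d_comp// -e Fd.
Qed.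

(** * Existence of boundary paths *)

(** One step of the construction of boundary paths. If [l = a c], exhaustiveness of [E] yields [mu]
    with [c u = mu t], so [l u = a mu t]. The prefix of [l] of degree [p] is unique, so one
    extension serves every [a]. *)
Lemma extend_through l p (E : set L) : exists l', prefix l l' /\
  forall a, kg_d a = p -> prefix a l -> FE (kg_s a) E ->
    exists mu, [/\ E mu, kg_s a = kg_r mu & prefix (kg_comp a mu) l'].
Proof.
have [[a [da al aE]]|n] :=
    pselect (exists a, [/\ kg_d a = p, prefix a l & FE (kg_s a) E]); last first.
  exists l; split; first exact: prefix_refl.
  by move=> a da al aE; case: n; exists a.
have [_ _ [EL Eexh]] := aE; have [c [ac lac]] := al.
have [mu Emu [[u t] [/= cu mut e _]]] := Eexh c (esym ac).
have amu : kg_s a = kg_r mu by rewrite EL.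
exists (kg_comp l u); split.
  by apply: prefix_comp; rewrite lac kg_s_comp.
move=> a' da' a'l _.
have -> : a' = a.
  apply: prefix_eq; last by rewrite da'.
  by apply: (prefix_total a'l al); rewrite da da' dle_refl.
exists mu; split=> //; exists t; rewrite kg_s_comp//; split=> //.
by rewrite lac -kg_compA// e kg_compA.
Qed.

(** Lets the construction return to each requirement at arbitrarily late stages. Countability of [L]
    turns finite sets of paths into finite sequences of numbers, which have numerical codes. *)
Lemma finite_subsets_enum : exists e : nat -> deg k * set L,
  forall p (E : set L), finite_set E -> forall i, exists2 j, (i <= j)%N & e j = (p, E).
Proof.
have [f finj] : exists f : L -> nat, injective f.
  have /pcard_leTP [f] := @kg_countable k L.
  by exists f => a b; apply: inj; rewrite ?inE.
pose dec (c : deg k * seq nat) := (c.1, [set l : L | f l \in c.2]).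
(* The 2-adic valuation of [j] is read as a code, with [(0, set0)] when it decodes to nothing. *)
pose e j := odflt (0, set0) (omap dec (unpickle (logn 2 j))).
exists e => p E /(finite_image f) /finite_seqP [s fEs] i.
pose c := pickle (p, s).
(* The factor [3 ^ i] pushes the index beyond [i] and leaves the 2-adic valuation at [c]. *)
exists (3 ^ i * 2 ^ c)%N.
  apply: leq_trans (ltnW (ltn_expl i (isT : 1 < 3)%N)) _.
  by rewrite leq_pmulr// expn_gt0.
rewrite /e logn_Gauss ?pfactorK ?coprimeXr// pickleK /= /dec /=.
congr pair; apply/seteqP; split=> l /=.
  move=> fl; have : [set` s] (f l) by [].
  by rewrite -fEs => -[l' El' /finj <-].
by move=> El; have : (f @` E) (f l) by [exists l]; rewrite fEs.
Qed.

(* Enumerate all pairs (p, E) with infinite repetition and meet one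
   requirement at each step; the limit of the resulting increasing sequence of
   paths is a boundary path. *)
Lemma boundary_path_through l : exists x, [/\ boundary_path x,
  dlee (kg_d l) (pd x) & px x 0 (kg_d l) = l].
Proof.
have [e eP] := finite_subsets_enum.
have /choice [g gP] (jl : nat * L) :=
  extend_through jl.2 (e jl.1).1 (e jl.1).2.
pose u := fix u j := if j is i.+1 then g (i, u i) else l.
have umono i j : (i <= j)%N -> prefix (u i) (u j).
  move=> /subnK <-; elim: (j - i)%N => [|t IH]; first exact: prefix_refl.
  by apply: prefix_trans IH _; exact: (gP (_, _)).1.
have [b bP] := edeg_sup (fun i j ij => prefix_dle (umono i j ij)).
(* [F q] is the prefix of degree [q] shared by all late [u j]. *)
have /choice [F FP] (q : deg k) : exists a, dlee q b ->
    kg_d a = q /\ exists j, prefix a (u j).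
  have [qb|] := pselect (dlee q b); last by exists l.
  have [j qj] := (bP q).1 qb; have [a da aj] := prefix_exists qj.
  by exists a => _; split=> //; exists j.
have cmp a c i j : prefix a (u i) -> prefix c (u j) -> dle (kg_d a) (kg_d c) ->
    prefix a c.
  move=> ai cj; apply: (@prefix_total _ _ (u (maxn i j))).
    by apply: prefix_trans ai _; apply: umono; exact: leq_maxl.
  by apply: prefix_trans cj _; apply: umono; exact: leq_maxr.
have Fu a j : prefix a (u j) -> dlee (kg_d a) b /\ F (kg_d a) = a.
  move=> aj; have ab : dlee (kg_d a) b.
    by apply/bP; exists j; exact: prefix_dle.
  split=> //; have [da [i ai]] := FP _ ab.
  by apply: prefix_eq => //; apply: (cmp _ _ _ _ ai aj); rewrite da dle_refl.
have Fd q : dlee q b -> kg_d (F q) = q by case/FP.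
have Fp p q : dle p q -> dlee q b -> prefix (F p) (F q).
  move=> pq qb; have [dq [j qj]] := FP _ qb.
  have [dp [i pi]] := FP _ (dlee_trans pq qb).
  by apply: (cmp _ _ _ _ pi qj); rewrite dp dq.
have [x [xb xf xF]] := kfunctor_of_prefixes Fd Fp.
have x0 q : dlee q b -> px x 0 q = F q.
  move=> qb; have [r ->] := xF _ _ (dle0 q) qb.
  (* [F 0] has degree 0, so it is an identity and composing with it changes nothing. *)
  have /kg_d0P [w Fw] := Fd _ (dlee0 b).
  move: r; rewrite Fw kg_s_id => ->; exact/esym/kg_id_comp.
have [lb Fl] := Fu l 0%N (prefix_refl l).
exists x; split; [split=> //| by rewrite xb|by rewrite x0].
move=> p; rewrite xb => pb E.
have [<- _] := xF _ _ (dle_refl p) pb; move=> FE_E; have [finE _ _] := FE_E.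
have [dp [i Fi]] := FP _ pb.
(* A stage [j] treating [(p, E)] once [F p] is already a prefix of [u j]: then [u j.+1] runs through
   [F p] followed by some [mu] in [E]. *)
have [j ij ej] := eP p E finE i.
have := (gP (j, u j)).2; rewrite ej /= => /(_ _ dp) [].
- exact: prefix_trans Fi (umono _ _ ij).
- exact: FE_E.
move=> mu [Emu amu pre].
have [] := Fu _ j.+1 pre; rewrite kg_d_comp// dp => mub Fmu.
exists mu; split=> //.
have [r e1] := xF _ _ (dle_addr p (kg_d mu)) mub.
have [] // : F p = F p /\ px x p (p + kg_d mu) = mu.
by apply: kg_comp_inj => //; rewrite -e1.
Qed.

(** * From entrances of generalized cycles to aperiodicity *)

Lemma aperiodic_of_entrances :
  (forall mu nu, generalized_cycle mu nu -> exists tau, entrance mu nu tau) ->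
  aperiodic L.
Proof.
move=> H v m n mn; apply: contrapT => per.
have {per} per x : boundary_path x -> prange x = v ->
    dlee (djoin m n) (pd x) /\ same_path (shift m x) (shift n x).
  move=> bx vx; split.
    by apply/negPn/negP => ?; apply: per; exists x; split=> //; left.
  by apply: contrapT => ?; apply: per; exists x; split=> //; right.
have [x [bx _]] := boundary_path_through (kg_id v); rewrite kg_d_id => x0.
have vx : prange x = v by rewrite /prange x0 kg_r_id.
have [mnx [spd sp]] := per x bx vx.
have xf := bx.1.
set J := djoin m n; pose l := px x 0 J.
have mJ : dle m J := dle_joinl m n.
have nJ : dle n J := dle_joinr m n.
have := kfunctor_shift0 xf (p := m) (q := dsub J m).
have := kfunctor_shift0 xf (p := n) (q := dsub J n).
rewrite !dsubKC// => /(_ mnx) [] + + /(_ mnx) [].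
set mu := px x 0 m; set nu := px x 0 n.
set a := px (shift m x) _ _; set b := px (shift n x) _ _.
move=> nub lb mua la.
have mx := dlee_trans mJ mnx; have nx := dlee_trans nJ mnx.
have dmu : kg_d mu = m by exact: kfunctor_d0.
have dnu : kg_d nu = n by exact: kfunctor_d0.
have dl : kg_d l = J by exact: kfunctor_d0.
have rl : kg_r l = v.
  by have [_ xrs _ _] := xf; rewrite (xrs _ _ (dle0 _) mnx).1.
have sal : kg_s a = kg_s l by rewrite /l la kg_s_comp.
have sbl : kg_s b = kg_s l by rewrite /l lb kg_s_comp.
have da : m + kg_d a = J by rewrite -{1}dmu -kg_d_comp// -la.
have db : n + kg_d b = J by rewrite -{1}dnu -kg_d_comp// -lb.
(* The first half makes [(a, b)] a generalized cycle; the second rules out every entrance. *)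
have key tau : kg_r tau = kg_s l -> MCE (kg_comp a tau) b !=set0 /\
    MCE a (kg_comp b tau) !=set0.
  move=> tl.
  have atau : kg_s a = kg_r tau by rewrite sal.
  have btau : kg_s b = kg_r tau by rewrite sbl.
  have [z [bz lz z0]] := boundary_path_through (kg_comp l tau).
  have vz : prange z = v.
    have [_ zrs _ _] := bz.1.
    by rewrite /prange -(zrs _ _ (dle0 _) lz).1 z0 kg_r_comp.
  have [mnz [spz sz]] := per z bz vz.
  have mz := dlee_trans mJ mnz; have nz := dlee_trans nJ mnz.
  have zf := bz.1.
  have [sm _] := boundary_shift mz bz; have [sn _] := boundary_shift nz bz.
  have lm : kg_comp l tau = kg_comp mu (kg_comp a tau).
    by rewrite /l la kg_compA.
  have ln : kg_comp l tau = kg_comp nu (kg_comp b tau).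
    by rewrite /l lb kg_compA.
  have dlm : kg_d (kg_comp l tau) = m + kg_d (kg_comp a tau).
    by rewrite lm kg_d_comp ?kg_r_comp// dmu.
  have dln : kg_d (kg_comp l tau) = n + kg_d (kg_comp b tau).
    by rewrite ln kg_d_comp ?kg_r_comp// dnu.
  have [rm em] := kfunctor_shift0 zf (p := m) (q := kg_d (kg_comp a tau))
    ltac:(by rewrite -dlm).
  have [rn en] := kfunctor_shift0 zf (p := n) (q := kg_d (kg_comp b tau))
    ltac:(by rewrite -dln).
  (* Cancelling [mu], respectively [nu], from the initial segment [l tau] of [z] exhibits [a tau]
     and [b tau] at the start of the two shifts. *)
  have [_ ezm] : px z 0 m = mu /\
      px (shift m z) 0 (kg_d (kg_comp a tau)) = kg_comp a tau.
    apply: kg_comp_inj; rewrite ?kg_r_comp//.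
      by rewrite dmu kfunctor_d0.
    by rewrite -em -lm -dlm.
  have [_ ezn] : px z 0 n = nu /\
      px (shift n z) 0 (kg_d (kg_comp b tau)) = kg_comp b tau.
    apply: kg_comp_inj; rewrite ?kg_r_comp//.
      by rewrite dnu kfunctor_d0.
    by rewrite -en -ln -dln.
  have am : dlee (kg_d (kg_comp a tau)) (pd (shift m z)).
    by rewrite dlee_shift// -dlm.
  have bm : dlee (kg_d (kg_comp b tau)) (pd (shift m z)).
    by rewrite spz dlee_shift// -dln.
  have {}ezn : px (shift m z) 0 (kg_d (kg_comp b tau)) = kg_comp b tau.
    by rewrite sz// dle0.
  have pfx c : kg_s c = kg_r tau -> dlee (kg_d (kg_comp c tau)) (pd (shift m z)) ->
     px (shift m z) 0 (kg_d (kg_comp c tau)) = kg_comp c tau ->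
     dlee (kg_d c) (pd (shift m z)) /\ px (shift m z) 0 (kg_d c) = c.
    move=> ctau cz ec; have cc := prefix_dle (prefix_comp ctau).
    have cz' := dlee_trans cc cz; split=> //.
    apply: prefix_eq; last by rewrite kfunctor_d0.
    apply: (@prefix_total _ _ (kg_comp c tau)).
    - by rewrite -[X in prefix _ X]ec; exact: kfunctor_prefix.
    - exact: prefix_comp.
    - by rewrite kfunctor_d0// dle_refl.
  have [am' ezm'] := pfx a atau am ezm; have [bm' ezn'] := pfx b btau bm ezn.
  (* All four paths are initial segments of the single path [shift m z], whose segment at the join
     of two degrees is a minimal common extension. *)
  by split; [rewrite -ezm -ezn'|rewrite -ezm' -ezn];
    eexists; exact: kfunctor_MCE.
have /H [tau [tb]] : generalized_cycle a b.
  split.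
  (* Since [m + kg_d a = J = n + kg_d b], equality of [a] and [b] would force [m = n]. *)
  - by move=> ab; apply: mn; move: da; rewrite ab -db [m + _]addrC [n + _]addrC => /daddrI.
  - by rewrite sal.
  (* The ranges of [a] and [b] are the initial vertices of the two shifts of [x], which coincide. *)
  - have mJx : dlee (dsub J m) (pd (shift m x)) by rewrite dlee_shift ?dsubKC.
    have nJx : dlee (dsub J n) (pd (shift n x)) by rewrite dlee_shift ?dsubKC.
    have [[_ xm _ _] _] := boundary_shift mx bx.
    have [[_ xn _ _] _] := boundary_shift nx bx.
    rewrite /a /b (xm _ _ (dle0 _) mJx).1 (xn _ _ (dle0 _) nJx).1.
    by rewrite sp// ?dle_refl// dlee0.
  - by move=> tau ta; apply: (key tau _).1; rewrite ta.
by have [_ [c]] := key tau (etrans tb sbl); move=> + e; rewrite e.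
Qed.

(** * From aperiodicity to entrances of initial cycles *)

Lemma entrance_of_aperiodic : aperiodic L ->
  forall mu, initial_cycle mu -> exists tau, cycle_entrance mu tau.
Proof.
move=> ap mu [[dmu smu] init]; apply: contrapT => noent.
set D := kg_d mu in dmu init; set v := kg_r mu in smu init.
(* Without an entrance, every path with range [v] has a common extension with [mu]; and [mu] is no
   vertex, its degree being nonzero. *)
have fe : FE v [set mu].
  split; first exact: finite_set1.
    move=> _ ->; split=> // e; apply: dmu; rewrite /D e; exact: kg_d_id.
  split=> [_ -> //|l lv]; exists mu => //.
  have /set0P [c [dc [a [b [mua lb ca cb]]]]] : MCE mu l != set0.
    apply/eqP => e; apply: noent; exists l; apply/cycle_entranceE.
    by split; rewrite // smu.
  exists (b, a); split=> //=; first by rewrite -ca -cb.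
  by rewrite -cb; split; [rewrite djoinC|exists b, a].
have step x : boundary_path x -> prange x = v ->
    [/\ dlee D (pd x), px x 0 D = mu, boundary_path (shift D x)
      & prange (shift D x) = v].
  move=> bx vx; have [xf xb] := bx.
  have [nu [-> Dx xD]] : exists nu, [/\ [set mu] nu, dlee (kg_d nu) (pd x)
      & px x 0 (kg_d nu) = nu].
    by have [nu] := xb 0 (dlee0 _) _ (eq_ind_r (fun w => FE w _) fe vx);
      rewrite add0r; exists nu.
  have bs := boundary_shift Dx bx; split=> //.
  rewrite /prange /= addr0 -smu -xD.
  by have [_ xrs _ _] := xf; rewrite (xrs _ _ (dle0 _) Dx).2.
(* Each induction step removes one copy of [mu] from both paths; their shifts by [D] are again
   boundary paths with range [v]. *)
have powers N : forall x y, boundary_path x -> prange x = v ->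
    boundary_path y -> prange y = v ->
    dlee (D *+ N) (pd x) /\ px x 0 (D *+ N) = px y 0 (D *+ N).
  elim: N => [|N IH] x y bx vx by_ vy.
    rewrite mulr0n dlee0; split=> //.
    have [[xid _ _ _] _] := bx; have [[yid _ _ _] _] := by_.
    rewrite xid ?dlee0// yid ?dlee0//; congr kg_id; by rewrite -!/(prange _) vx.
  have [Dx xD bsx vsx] := step x bx vx; have [Dy yD bsy vsy] := step y by_ vy.
  have [lex e] := IH _ _ bsx vsx bsy vsy; have [ley _] := IH _ _ bsy vsy bsx vsx.
  move: lex ley; rewrite !dlee_shift// -mulrS => lex ley; split=> //.
  move: lex ley; rewrite mulrS => lex ley.
  rewrite (kfunctor_shift0 bx.1 lex).2 (kfunctor_shift0 by_.1 ley).2.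
  by rewrite e xD yD.
(* The degree is forced: where [D i] is 0, initiality forbids edges in direction [i] at [v];
   elsewhere a finite value [c] is exceeded by [c.+1] copies of [D]. *)
have dx x i : boundary_path x -> prange x = v ->
    pd x i = if D i == 0%N then Some 0%N else None.
  move=> bx vx; case: eqP => Di.
    have /forallPn [j] : ~~ dlee (dgen i) (pd x).
      apply/negP => ex; have [_ xrs _ _] := bx.1.
      have : (set0 : set L) (px x 0 (dgen i)); last by [].
      rewrite -(init _ Di); split; last by rewrite kfunctor_d0//; exact: bx.1.
      by rewrite (xrs _ _ (dle0 _) ex).1.
    by rewrite ffunE; case: (j =P i) => [->|_]; case: (pd x _) => // -[].
  case exi : (pd x i) => [c|//].
  have [/forallP /(_ i)] := powers c.+1 x x bx vx bx vx.
  rewrite exi ffunMnE -mulr_natr natn => le_c.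
  have : (c.+1 <= c)%N; last by rewrite ltnn.
  by apply: leq_trans le_c; apply: leq_pmull; rewrite lt0n; apply/eqP.
(* Invariance under the shift by [D] is tested against the pair [D], [0]. *)
have [x [bx vx per]] := ap v D 0 dmu.
have [Dx _ bs vs] := step x bx vx.
have J0 : djoin D 0 = D by apply/ffunP => i; rewrite !ffunE; exact: maxn0.
have s0 : shift 0 x = x.
  case: x {bx vx per Dx bs vs} => b f; rewrite /shift /=; congr PathData.
    by apply/ffunP => i; rewrite !ffunE; case: (b i) => // c; rewrite subn0.
  by apply/funext => p; apply/funext => q; rewrite !add0r.
case: per; first by rewrite J0 Dx.
rewrite s0; apply; apply: same_path_prefix; [exact: bs.1|exact: bx.1| |].
  by apply/ffunP => i; rewrite !dx.
(* The sum bounds every [q i], so [D *+ N] dominates [q] where [D i] is positive; elsewhere the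
   degree of the path forces [q i] to be 0. *)
move=> q qx; pose N := (\sum_i q i)%N; exists (D *+ N).
have [DN e] := powers N _ _ bs vs bx vx; split=> //.
apply/dleP => i; have /forallP /(_ i) := qx; rewrite dx//.
rewrite ffunMnE -mulr_natr natn; case: (D i =P 0%N) => [_|/eqP Di _].
  by rewrite leqn0 => /eqP ->.
apply: (@leq_trans N); first by rewrite /N (bigD1 i)//= leq_addr.
by apply: leq_pmull; rewrite lt0n.
Qed.

End Paths.

Theorem corollary4p5 (k : nat) (hk : 0 < k) (L : kgraph k)
    (hL : finitely_aligned L) :
  ((forall mu nu : L, generalized_cycle mu nu ->
      exists tau : L, entrance mu nu tau) -> aperiodic L) /\
  (aperiodic L -> forall mu : L, initial_cycle mu ->
      exists tau : L, cycle_entrance mu tau).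
Proof.
by split; [exact: aperiodic_of_entrances|exact: entrance_of_aperiodic].
Qed.
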